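(* For every integer $d\ge 2$, the family $\{\tilde P_m : m\in\mathbb N,\ m\ge1\}$ of reduced limit polynomials of the Chacon$_{(3)}$ transformation contains infinitely many polynomials of degree $d$.
   Context: Chacon$_{(3)}$ transformation: consider the substitution $0\mapsto 0010$, $1\mapsto 1$ on the alphabet $\{0,1\}$. Put $w_0=0$ and let $w_{n+1}$ be obtained from $w_n$ by applying the substitution to each letter. Each $w_n$ is a prefix of $w_{n+1}$; let $w_\infty$ be the one-sided infinite word having all $w_n$ as prefixes. Let $X\subset\{0,1\}^{\mathbb Z}$ be the set of two-sided sequences all of whose finite subwords occur in $w_\infty$, $\mathcal B$ its Borel $\sigma$-algebra, $T$ the left shift on $X$, and $\mu$ the $T$-invariant probability measure giving each cylinder the asymptotic frequency of the corresponding word in $w_\infty$. Let $(\hat Tf)(x)=f(Tx)$ be the Koopman operator on $L^2(X,\mu)$, and let $h_n$ be the length of $w_n$, so $h_0=1$, $h_{n+1}=3h_n+1$. Limit polynomials: let $\Gamma=\mathbb Z_3$ be the compact group of $3$-adic integers, identified with sequences $y=(y_1,y_2,\dots)$, $y_k\in\{0,1,2\}$ ($y$ represents $\sum_{k\ge1}y_k3^{k-1}$), with Haar probability measure, and let $Sy=y+1$. For $y\in\Gamma$ let $\phi_0(y)=0$ if the first digit of $y$ different from $2$ is $0$, and $\phi_0(y)=1$ if it is $1$ (put $\phi_0=0$ at the null point $(2,2,2,\dots)$). For $m\ge1$ let $\phi_0^{(m)}(y)=\sum_{i=0}^{m-1}\phi_0(S^iy)$ and let $\rho_m$ be the image of Haar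 probability measure under $\phi_0^{(m)}$, a finitely supported probability measure on $\mathbb Z_{\ge0}$. The limit polynomial is $$P_m(z)=\sum_{k}\rho_m(\{k\})z^k ,$$ which is the polynomial with $P_m(\hat T)=\lim_{n\to\infty}\hat T^{-mh_n}$ (weak operator limit). Reduced limit polynomials: $\tilde P_m(z)=z^{-l_m}P_m(z)$, where $l_m$ is the smallest exponent $k$ for which $z^k$ has a nonzero coefficient in $P_m(z)$. For instance $\tilde P_1(z)=\frac12(1+z)$, $\tilde P_2(z)=\frac16(1+4z+z^2)$, $\tilde P_4(z)=\frac19(2+5z+2z^2)$. *)

(* Defs.v *)
From HB Require Import structures.
From mathcomp Require Import all_boot all_order all_algebra.
From mathcomp Require Import all_classical all_reals all_analysis.
From mathcomp Require Import zify ring lra.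

Set Implicit Arguments.
Unset Strict Implicit.
Unset Printing Implicit Defensive.

Import Order.TTheory GRing.Theory Num.Theory.
Local Open Scope classical_set_scope.
Local Open Scope ring_scope.

Definition digits := nat -> 'I_3.

HB.instance Definition _ := Choice.copy digits (nat -> 'I_3).
HB.instance Definition _ := isPointed.Build digits (fun=> ord0).

Definition coordinate_cylinders : set (set digits) :=
  [set A | exists k i, A = [set y : digits | y k = i]].

(** The 3-adic integers: [y] stands for [\sum_k y k * 3 ^ k] (so [y k] is the
    digit usually numbered [k.+1]). The Borel sigma-algebra of this countable
    product of finite discrete spaces is generated by the coordinate cylinders. *)
Definition Z3 := g_sigma_algebraType coordinate_cylinders.

(** Addition with carry: the first [k.+1] digits of [x + y] are those of the sum
    of the truncations of [x] and [y] to [k.+1] digits. *)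
Definition add3 (x y : Z3) : Z3 := fun k =>
  inord ((\sum_(i < k.+1) (x i + y i) * 3 ^ i) %/ 3 ^ k %% 3)%N.

Definition one3 : Z3 := fun k => inord (k == 0%N).

Definition S3 (y : Z3) : Z3 := add3 y one3.

Definition is_haar (R : realType) (mu : probability Z3 R) : Prop :=
  forall (a : Z3) (A : set Z3), measurable A -> mu (add3 a @^-1` A) = mu A.

Definition phi0 (y : Z3) : nat :=
  if pselect (exists k, (y k != 2 :> nat)%N) is left nz then y (ex_minn nz)
  else 0%N.

Definition phi0_sum (m : nat) (y : Z3) : nat :=
  (\sum_(i < m) phi0 (iter i S3 y))%N.

Definition rho (R : realType) (mu : probability Z3 R) (m : nat) :
    set nat -> \bar R := pushforward mu (phi0_sum m).

(** [phi0] takes values in {0, 1}, so that [rho mu m] is carried by {0, ..., m}. *)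
Definition limit_poly (R : realType) (mu : probability Z3 R) (m : nat) :
    {poly R} := \poly_(k < m.+1) fine (rho mu m [set (k : nat)]).

(** The index of the first nonzero coefficient (for nonzero [p]). *)
Definition low_exp (R : realType) (p : {poly R}) : nat :=
  find (fun c => c != 0) p.

Definition reduced_limit_poly (R : realType) (mu : probability Z3 R)
    (m : nat) : {poly R} :=
  drop_poly (low_exp (limit_poly mu m)) (limit_poly mu m).

(** Existence of the Haar probability measure: the image of Lebesgue measure on
    [[0, 1[] under ternary expansion. *)
Section HaarExistence.

Let pw (n : nat) : (0 < 3 ^ n)%N. Proof. by rewrite expn_gt0. Qed.

Definition residue (n : nat) (y : Z3) : nat := (\sum_(i < n) y i * 3 ^ i)%N.

Lemma residueS n y : residue n.+1 y = (residue n y + y n * 3 ^ n)%N.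
Proof. by rewrite /residue big_ord_recr. Qed.

Lemma residue_lt n y : (residue n y < 3 ^ n)%N.
Proof.
elim: n => [|n ih]; first by rewrite /residue big_ord0.
rewrite residueS expnS; have := ltn_ord (y n); nia.
Qed.

Lemma residueS_mod n y : (residue n.+1 y %% 3 ^ n)%N = residue n y.
Proof. by rewrite residueS addnC modnMDl modn_small// residue_lt. Qed.

Lemma residueS_div n y : (residue n.+1 y %/ 3 ^ n)%N = y n.
Proof.
by rewrite residueS addnC divnMDl ?pw// divn_small ?addn0// residue_lt.
Qed.

Lemma residue_mod m n y : (m <= n)%N -> (residue n y %% 3 ^ m)%N = residue m y.
Proof.
elim: n => [|n ih].
  by rewrite leqn0 => /eqP ->; rewrite modn_small// residue_lt.
rewrite leq_eqVlt => /orP[/eqP ->|]; first by rewrite modn_small// residue_lt.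
rewrite ltnS => mn.
rewrite -ih// -(residueS_mod n) modn_dvdm//; exact: dvdn_exp2l.
Qed.

Lemma residue_add n x y :
  residue n (add3 x y) = ((residue n x + residue n y) %% 3 ^ n)%N.
Proof.
elim: n => [|n ih]; first by rewrite /residue !big_ord0.
rewrite residueS ih.
have -> : nat_of_ord (add3 x y n) =
    ((residue n.+1 x + residue n.+1 y) %/ 3 ^ n %% 3)%N.
  rewrite /add3 inordK ?ltn_mod//; congr (_ %/ _ %% _)%N.
  by rewrite /residue -big_split/=; apply: eq_bigr => i _; rewrite mulnDl.
set s := (residue n.+1 x + residue n.+1 y)%N.
have -> : ((residue n x + residue n y) %% 3 ^ n = s %% 3 ^ n)%N.
  by rewrite /s -(residueS_mod n x) -(residueS_mod n y) modnDm.
have e : s = (s %/ 3 ^ n %/ 3 * 3 ^ n.+1 +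
    (s %% 3 ^ n + s %/ 3 ^ n %% 3 * 3 ^ n))%N.
  rewrite {1}(divn_eq s (3 ^ n)) {1}(divn_eq (s %/ 3 ^ n) 3) expnS; nia.
have lt : (s %% 3 ^ n + s %/ 3 ^ n %% 3 * 3 ^ n < 3 ^ n.+1)%N.
  have := ltn_pmod s (pw n); have := ltn_pmod (s %/ 3 ^ n) (isT : 0 < 3)%N.
  rewrite expnS; nia.
by rewrite [in RHS]e modnMDl (modn_small lt).
Qed.

Definition cylinder n j : set Z3 := [set y | residue n y = j].

Definition cylinders : set (set Z3) :=
  [set A | A = set0 \/ exists n j, A = cylinder n j].

Lemma setI_closed_cylinders : setI_closed cylinders.
Proof.
have aux m i n j : (m <= n)%N -> cylinders (cylinder m i `&` cylinder n j).
  move=> mn; have [e|ne] := eqVneq (j %% 3 ^ m)%N i.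
    right; exists n, j; apply/seteqP; split => [y []//|y yj]; split => //.
    by rewrite /cylinder/= -(residue_mod y mn) yj.
  left; apply/seteqP; split => // y [/= yi yj]; move/eqP: ne; apply.
  by rewrite -yj residue_mod.
move=> A B [->|[m [i ->]]] [->|[n [j ->]]]; rewrite ?set0I ?setI0; try by left.
by case/orP: (leq_total m n) => h; [|rewrite setIC]; exact: aux.
Qed.

Lemma measurable_cylinder n j : measurable (cylinder n j).
Proof.
elim: n j => [|n ih] j.
  have [->|j0] := eqVneq j 0%N.
    rewrite (_ : cylinder _ _ = setT)//; apply/seteqP; split => // y _.
    by rewrite /cylinder/= /residue big_ord0.
  rewrite (_ : cylinder _ _ = set0)//; apply/seteqP; split => // y.
  by rewrite /cylinder/= /residue big_ord0 => e; rewrite -e eqxx in j0.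
have [jlt|jge] := ltnP (j %/ 3 ^ n) 3; last first.
  rewrite (_ : cylinder _ _ = set0)//; apply/seteqP; split => // y.
  rewrite /cylinder/= => e; move: jge; rewrite -e residueS_div.
  by rewrite leqNgt ltn_ord.
rewrite (_ : cylinder _ _ =
    cylinder n (j %% 3 ^ n) `&` [set y : Z3 | y n = Ordinal jlt]).
  apply: measurableI => //; apply: sub_sigma_algebra; by exists n, (Ordinal jlt).
apply/seteqP; split => y.
  rewrite /cylinder/= => e; split; first by rewrite -e residueS_mod.
  by apply/val_inj => /=; rewrite -e residueS_div.
rewrite /cylinder/= => -[e1 e2]; rewrite residueS e1 e2/= addnC.
by rewrite -divn_eq.
Qed.

Lemma measurable_cylindersE :
  (measurable : set (set Z3)) = <<s cylinders >>.
Proof.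
apply/seteqP; split; last first.
  apply: smallest_sub; first exact: sigma_algebra_measurable.
  by move=> A [->//|[n [j ->]]]; exact: measurable_cylinder.
apply: smallest_sub; first exact: smallest_sigma_algebra.
move=> A [k [i ->]].
rewrite (_ : [set y : digits | y k = i] =
    \bigcup_(j in [set j | j %/ 3 ^ k = i]%N) cylinder k.+1 j).
  apply: (@bigcup_measurable _ (g_sigma_algebraType cylinders)) => j _.
  by apply: sub_sigma_algebra; right; exists k.+1, j.
apply/seteqP; split => [y /= yi|y [j /= ji]].
  by exists (residue k.+1 y) => //=; rewrite residueS_div yi.
by rewrite /cylinder/= => e; apply/val_inj => /=; rewrite -ji -e residueS_div.
Qed.

Variable R : realType.

Definition ternary (x : R) : Z3 :=
  fun k => inord (Num.truncn (3 ^+ k.+1 * x) %% 3).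

Lemma truncn_mul3 (x : R) : 0 <= x ->
  (Num.truncn (3 * x) %/ 3)%N = Num.truncn x.
Proof.
move=> x0; apply/esym/truncn_def.
have := truncn_itv (mulr_ge0 (ler0n R 3) x0).
set t := Num.truncn _ => /andP[t1 t2].
have d := divn_eq t 3; have r := ltn_pmod t (isT : 0 < 3)%N.
have h1 : (t %/ 3 * 3 <= t)%N by lia.
have h2 : (t.+1 <= (t %/ 3).+1 * 3)%N by lia.
rewrite -(ler_nat R) natrM in h1; rewrite -(ler_nat R) natrM in h2.
by apply/andP; split; lra.
Qed.

Lemma ternary_cylinder n j : (j < 3 ^ n)%N -> exists2 N : nat, (N < 3 ^ n)%N &
  forall x : R, 0 <= x < 1 ->
    (residue n (ternary x) = j <-> Num.truncn (3 ^+ n * x) = N).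
Proof.
elim: n j => [|n ih] j jn.
  exists 0%N => // x /andP[x0 x1].
  have -> : Num.truncn (3 ^+ 0 * x) = 0%N.
    by apply: truncn_def; rewrite expr0 mul1r x0.
  rewrite /residue big_ord0; move: jn; rewrite expn0 ltnS leqn0 => /eqP ->.
  by [].
have [|N Nn hN] := ih (j %% 3 ^ n)%N; first by rewrite ltn_mod.
have dn : (j %/ 3 ^ n < 3)%N by rewrite ltn_divLR// -expnS.
exists (N * 3 + j %/ 3 ^ n)%N; first by rewrite expnS; nia.
move=> x x01; have := hN x x01.
have x0 : 0 <= x by case/andP: x01.
have := truncn_mul3 (mulr_ge0 (exprn_ge0 n (ler0n R 3)) x0).
rewrite mulrA -exprS; set t := Num.truncn _; set u := Num.truncn _ => tu hu.
have e : residue n.+1 (ternary x) = (residue n (ternary x) + t %% 3 * 3 ^ n)%N.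
  by rewrite residueS /ternary inordK// ltn_mod.
have r := residue_lt n (ternary x).
have dj := divn_eq j (3 ^ n)%N.
have dt := divn_eq t 3; have rt := ltn_pmod t (isT : 0 < 3)%N.
rewrite tu in dt.
split => [ej|et].
  have e1 : residue n (ternary x) = (j %% 3 ^ n)%N.
    by rewrite -ej residueS_mod.
  have e2 : (t %% 3 = j %/ 3 ^ n)%N.
    by rewrite -ej e addnC divnMDl ?pw// divn_small ?addn0.
  by rewrite dt e2 (hu.1 e1).
have [e1 e2] : u = N /\ (t %% 3 = j %/ 3 ^ n)%N.
  move: et dt rt dn; move: (j %/ 3 ^ n)%N (t %% 3)%N => a b.
  by clearbody t u; clear; lia.
by rewrite e e2 (hu.2 e1) [RHS]dj addnC.
Qed.

Lemma measurable_ternary : measurable_fun setT ternary.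
Proof.
apply: (@measurability _ _ _ _ setT ternary coordinate_cylinders) => //.
move=> _ [_ [k [i ->] <-]]; rewrite setTI.
rewrite (_ : _ @^-1` _ = \bigcup_(N in [set N | N %% 3 = i]%N)
   [set x | Num.truncn (3 ^+ k.+1 * x) = N]); last first.
  apply/seteqP; split => [x /= e|x [N /= e1 e2]].
    by exists (Num.truncn (3 ^+ k.+1 * x)) => //=; rewrite -e /ternary inordK// ltn_mod.
  by apply/val_inj; rewrite /ternary/= inordK ?ltn_mod// e2 e1.
apply: bigcup_measurable => N _.
have p3 : 0 < 3 ^+ k.+1 :> R by rewrite exprn_gt0.
case: N => [|N].
  rewrite (_ : mkset _ = [set` `]-oo, (3 ^+ k.+1)^-1[%R])//.
  apply/seteqP; split => x /=; rewrite in_itv/= -[_^-1]mulr1 ltr_pdivlMl//.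
    by move=> e; rewrite -[1]/(1%:R) -truncn_le_nat e.
  by move=> h; apply/eqP; rewrite -leqn0 truncn_le_nat.
rewrite (_ : mkset _ = [set` `[(3 ^+ k.+1)^-1 * N.+1%:R, (3 ^+ k.+1)^-1 * N.+2%:R[%R])//.
apply/seteqP; split => x /=; rewrite in_itv/= ler_pdivrMl// ltr_pdivlMl//.
  move=> e; rewrite -e; apply: truncn_itv; apply: (le_trans ler01).
  by rewrite -[1]/(1%:R) -truncn_gt_nat e.
exact: truncn_def.
Qed.

Let itv01 : set R := [set` `[0%R, 1%R[].
Let mitv01 : measurable itv01. Proof. exact: measurable_itv. Qed.

Let image_measure : {measure set Z3 -> \bar R} :=
  @measure_function_pushforward__canonical__measure_function_Measure
    _ _ _ _ _ (mrestr lebesgue_measure mitv01) _ measurable_ternary.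

Definition ternary_image (A : set Z3) : \bar R := image_measure A.

HB.instance Definition _ := isMeasure.Build _ _ _ ternary_image
  (measure0 image_measure) (measure_ge0 image_measure)
  (@measure_semi_sigma_additive _ _ _ image_measure).

Let ternary_imageE A :
  ternary_image A = lebesgue_measure (ternary @^-1` A `&` itv01).
Proof. by []. Qed.

Let ternary_image_setT : ternary_image setT = 1%E.
Proof.
rewrite ternary_imageE preimage_setT setTI /itv01 lebesgue_measure_itv/=.
by rewrite lte_fin ltr01 -EFinD subr0.
Qed.

HB.instance Definition _ := Measure_isProbability.Build _ _ _ ternary_image
  ternary_image_setT.

Lemma ternary_image_cylinder n j : (j < 3 ^ n)%N ->
  ternary_image (cylinder n j) = ((3 ^- n)%:E)%E.
Proof.
move=> jn; rewrite ternary_imageE; have [N Nn hN] := ternary_cylinder jn.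
have p3 : 0 < 3 ^+ n :> R by rewrite exprn_gt0.
rewrite (_ : _ `&` _ = [set` `[3 ^- n * N%:R, 3 ^- n * N.+1%:R[%R]).
  rewrite lebesgue_measure_itv/= lte_fin ltr_pM2l ?invr_gt0// ltr_nat ltnSn.
  by rewrite -EFinD -mulrBr -natrB// subSnn mulr1.
apply/seteqP; split => x; rewrite /= in_itv/= ler_pdivrMl// ltr_pdivlMl//.
  move=> [xj]; rewrite /itv01/= in_itv/= => x01; rewrite -((hN x x01).1 xj).
  by apply: truncn_itv; rewrite mulr_ge0 ?(ltW p3)//; case/andP: x01.
move=> h; have x01 : 0 <= x < 1.
  case/andP: h => h1 h2; apply/andP; split.
    by rewrite -(pmulr_rge0 _ p3); apply: le_trans h1; rewrite ler0n.
  rewrite -(ltr_pM2l p3) mulr1; apply: (lt_le_trans h2).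
  by rewrite -natrX ler_nat.
split; last by rewrite /itv01/= in_itv.
by apply/(hN x x01); exact: truncn_def.
Qed.

Lemma measurable_add3 (a : Z3) : measurable_fun setT (add3 a).
Proof.
apply: (@measurability _ _ _ _ setT _ cylinders).
  exact: measurable_cylindersE.
move=> _ [_ [->|[n [j ->]]] <-]; rewrite setTI ?preimage_set0//.
rewrite (_ : _ @^-1` _ = \bigcup_(i in
    [set i | (residue n a + i) %% 3 ^ n = j]%N) cylinder n i).
  by apply: bigcup_measurable => i _; exact: measurable_cylinder.
apply/seteqP; split => [y|y [i /= e1]]; rewrite /cylinder/= residue_add.
  by exists (residue n y).
by move=> ->.
Qed.

Lemma haar_exists : exists mu : probability Z3 R, is_haar mu.
Proof.
exists ternary_image => a A mA.
pose m2 : {measure set Z3 -> \bar R} :=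
  @measure_function_pushforward__canonical__measure_function_Measure
    _ _ _ _ _ ternary_image _ (measurable_add3 a).
have c0 : cylinder 0 0 = setT.
  by apply/seteqP; split => // y _; rewrite /cylinder/= /residue big_ord0.
have cylinders_measurable : cylinders `<=` measurable.
  by move=> B [->//|[n [j ->]]]; exact: measurable_cylinder.
have sA : <<s cylinders >> A by rewrite -measurable_cylindersE.
suff agree B : cylinders B -> m2 B = ternary_image B.
  apply: (@g_sigma_algebra_measure_unique _ _ _ _ cylinders_measurable
    (fun=> cylinder 0 0) _ _ m2 ternary_image) sA => //.
  - by move=> _; right; exists 0%N, 0%N.
  - by rewrite bigcup_const// c0.
  - exact: setI_closed_cylinders.
  - move=> _; rewrite c0; have -> : m2 setT = ternary_image setT by [].
    by rewrite ternary_image_setT ltry.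
move=> [->|[n [j ->]]]; first by rewrite !measure0.
have [jn|jn] := ltnP j (3 ^ n)%N; last first.
  rewrite (_ : cylinder n j = set0) ?measure0//; apply/seteqP; split => // y.
  by rewrite /cylinder/= => e; have := residue_lt n y; rewrite e ltnNge jn.
have ra := residue_lt n a.
pose i := ((j + (3 ^ n - residue n a)) %% 3 ^ n)%N.
have -> : m2 (cylinder n j) = ternary_image (cylinder n i).
  rewrite /m2/= /pushforward; congr ternary_image.
  apply/seteqP; split => y; rewrite /cylinder/= residue_add.
    move=> e; rewrite /i -e modnDml addnAC subnKC ?(ltnW ra)//.
    by rewrite modnDl modn_small// residue_lt.
  move=> ->; rewrite /i modnDmr addnCA subnKC ?(ltnW ra)//.
  by rewrite modnDr modn_small.
by rewrite !ternary_image_cylinder// ltn_mod.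
Qed.

End HaarExistence.

(* Main.v *)
Require Import Defs.
From HB Require Import structures.
From mathcomp Require Import all_boot all_order all_algebra.
From mathcomp Require Import all_classical all_reals all_analysis.
From mathcomp Require Import zify ring lra.

(* Splitting [m] consecutive 3-adic integers according to their lowest digit
   gives, for the limit polynomials,
     [P_(3k) = z^k P_k],
     [P_(3k+1) = z^k ((1 + z) P_k + P_(k+1)) / 3],
     [P_(3k+2) = z^k (z P_k + (1 + z) P_(k+1)) / 3].
   Hence the degree of the reduced polynomial of [k] with ternary digits
   [1...1] ([n] of them) is [n], and that of [3^i k + 1] is [n + 1] for all [i].
   If [a] and [b_i] are the constant terms of the reduced polynomials of [k] and
   [3^i k + 1], then [b_(i+1) = (a + b_i) / 3], so [b_i - a / 2] decays exactly
   like [3^-i], and these reduced polynomials are distinct once [b_0 < a / 2]. *)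

Import Order.TTheory GRing.Theory Num.Theory.
Local Open Scope classical_set_scope.
Local Open Scope ring_scope.

(** * The successor [S3] in terms of lowest digit and tail *)

Definition tail3 (y : Z3) : Z3 := fun k => y k.+1.

Lemma residue_tail3 n y : residue n.+1 y = (y 0%N + residue n (tail3 y) * 3)%N.
Proof.
rewrite /residue big_ord_recl expn0 muln1 big_distrl/=; congr (_ + _)%N.
by apply: eq_bigr => i _; rewrite /bump/= add1n expnS mulnAC mulnA.
Qed.

Lemma residue_inj (x y : Z3) : (forall n, residue n x = residue n y) -> x = y.
Proof.
by move=> e; apply/funext => k; apply/val_inj; rewrite /= -!residueS_div e.
Qed.

Lemma residue_S3 n y : residue n (S3 y) = ((residue n y).+1 %% 3 ^ n)%N.
Proof.
rewrite /S3 residue_add; case: n => [|n]; first by rewrite expn0 !modn1.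
rewrite (_ : residue n.+1 one3 = 1%N) ?addn1//.
rewrite /residue big_ord_recl big1 => [|i _]; first by rewrite inordK.
by rewrite inordK.
Qed.

Lemma S3_digit0 y : S3 y 0%N = ((y 0%N).+1 %% 3)%N :> nat.
Proof.
have r z : residue 1 z = z 0 by rewrite /residue big_ord1 muln1.
by have := residue_S3 1 y; rewrite !r.
Qed.

Lemma tail3_S3 y :
  tail3 (S3 y) = if y 0%N == 2%N :> nat then S3 (tail3 y) else tail3 y.
Proof.
apply: residue_inj => n.
(* Dropping the lowest digit is integer division by 3, so a carry shows up as the quotient by 3
   increasing by one. *)
have d z : residue n (tail3 z) = (residue n.+1 z %/ 3)%N.
  by rewrite residue_tail3 addnC divnMDl// divn_small ?addn0.
rewrite d residue_S3 expnSr -modn_divl residue_tail3.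
have := residue_lt n (tail3 y); have := ltn_ord (y 0%N).
case: eqP => [->|ny] y3 rn.
  rewrite residue_S3; congr (_ %% _)%N; lia.
rewrite -[RHS](modn_small rn); congr (_ %% _)%N; lia.
Qed.

(** * Sums of [phi0] along orbits of [S3] *)

Lemma phi0_digit0 (y : Z3) : y 0%N != 2%N :> nat -> phi0 y = y 0%N.
Proof.
move=> y2; rewrite /phi0; case: pselect => [nz|[]]; last by exists 0%N.
by case: ex_minnP => -[//|k] _ /(_ 0%N y2).
Qed.

(** A lowest digit 2 is skipped in the search for the first digit other than 2; if every digit is 2,
    both sides take the default value 0. *)
Lemma phi0_tail3 (y : Z3) : y 0%N = 2%N :> nat -> phi0 y = phi0 (tail3 y).
Proof.
move=> y2; rewrite /phi0; case: pselect => nz; case: pselect => nz'//.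
- case: ex_minnP => -[|k] yk kmin; first by rewrite y2 in yk.
  case: ex_minnP => j yj jmin; suff -> : k = j by [].
  by apply/eqP; rewrite eqn_leq (jmin k)// andbT -ltnS kmin.
- have [[|k] yk] := nz; first by rewrite y2 in yk.
  by case: nz'; exists k.
- by case: nz; have [k yk] := nz'; exists k.+1.
Qed.

Lemma phi0_sumD m n y :
  phi0_sum (m + n) y = (phi0_sum m y + phi0_sum n (iter m S3 y))%N.
Proof.
rewrite /phi0_sum big_split_ord/=; congr (_ + _)%N.
by apply: eq_bigr => i _; rewrite addnC iterD.
Qed.

Lemma phi0_sum1 y : phi0_sum 1 y = phi0 y.
Proof. by rewrite /phi0_sum big_ord1. Qed.

Lemma digit0_cases (y : Z3) :
  [\/ y 0%N = 0%N :> nat, y 0%N = 1%N :> nat | y 0%N = 2%N :> nat].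
Proof.
by case: (y 0%N) => -[|[|[|//]]] h; [constructor 1|constructor 2|constructor 3].
Qed.

Lemma S3_3 y : S3 (S3 (S3 y)) 0%N = y 0%N /\
  tail3 (S3 (S3 (S3 y))) = S3 (tail3 y).
Proof.
split; first by apply/val_inj; rewrite /= !S3_digit0;
  case: (digit0_cases y) => ->.
by rewrite !tail3_S3 !S3_digit0; case: (digit0_cases y) => ->.
Qed.

Lemma S3_mul3 k y : iter (k * 3) S3 y 0%N = y 0%N /\
  tail3 (iter (k * 3) S3 y) = iter k S3 (tail3 y).
Proof.
elim: k => // k [ih0 ihT]; rewrite mulSn iterD /=.
by have [-> ->] := S3_3 (iter (k * 3) S3 y); rewrite ih0 ihT.
Qed.

(** Each lowest digit occurs once among three consecutive points. Digits 0 and 1 contribute 0 and 1;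
    at digit 2 [phi0] reads the tail, which is still [tail3 y] because the carry comes only
    afterwards. *)
Lemma phi0_sum3 y : phi0_sum 3 y = (phi0 (tail3 y)).+1.
Proof.
rewrite /phi0_sum !big_ord_recr big_ord0/= add0n.
have e1 := S3_digit0 y; have e2 := S3_digit0 (S3 y).
have t1 := tail3_S3 y; have t2 := tail3_S3 (S3 y).
case: (digit0_cases y) => y0; rewrite y0/= in e1 t1; rewrite e1/= in e2 t2;
  rewrite t1 in t2.
- by rewrite (@phi0_digit0 y) ?y0// (@phi0_digit0 (S3 y)) ?e1// phi0_tail3 ?t2.
- rewrite (@phi0_digit0 y) ?y0// (@phi0_tail3 (S3 y)) ?e1//.
  by rewrite (@phi0_digit0 (S3 (S3 y))) ?e2// t1 addn0 add1n.
- rewrite (@phi0_tail3 y) ?y0// (@phi0_digit0 (S3 y)) ?e1//.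
  by rewrite (@phi0_digit0 (S3 (S3 y))) ?e2// addn0 addn1.
Qed.

Lemma phi0_sum_mul3 k y : phi0_sum (k * 3) y = (k + phi0_sum k (tail3 y))%N.
Proof.
elim: k y => [|k ih] y; first by rewrite /phi0_sum !big_ord0.
rewrite mulSn phi0_sumD ih phi0_sum3 /=; have [_ ->] := S3_3 y.
by rewrite -[in RHS](add1n k) phi0_sumD phi0_sum1/=; lia.
Qed.

(** The leftover point [iter (k * 3) S3 y] has the lowest digit of [y]: digit 2 supplies the next
    term of the sum along the tail, any other digit contributes itself. *)
Lemma phi0_sum_mul3D1 k y : phi0_sum (k * 3 + 1) y =
  if y 0%N == 2%N :> nat then (k + phi0_sum k.+1 (tail3 y))%N
  else (k + y 0%N + phi0_sum k (tail3 y))%N.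
Proof.
rewrite phi0_sumD phi0_sum_mul3 phi0_sum1 -(addn1 k) phi0_sumD phi0_sum1.
have [e t] := S3_mul3 k y; case: eqP => y0.
  by rewrite phi0_tail3 ?e// t addnA.
by rewrite phi0_digit0 ?e//; [lia|exact/eqP].
Qed.

(** The two leftover points have lowest digits (0,1), (1,2) or (2,0); only the first pair never
    reads the tail. *)
Lemma phi0_sum_mul3D2 k y : phi0_sum (k * 3 + 2) y =
  if y 0%N == 0%N :> nat then (k.+1 + phi0_sum k (tail3 y))%N
  else (k + (y 0%N == 1%N :> nat) + phi0_sum k.+1 (tail3 y))%N.
Proof.
rewrite -[2%N]/(1 + 1)%N addnA phi0_sumD phi0_sum_mul3D1 phi0_sum1.
rewrite (addn1 (k * 3)) -(addn1 k) phi0_sumD phi0_sum1 iterS.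
have [e t] := S3_mul3 k y.
set x := iter (k * 3) S3 y in e t *.
have := S3_digit0 x; have := tail3_S3 x; rewrite e t.
case: (digit0_cases y) => -> /= tS eS.
- by rewrite (@phi0_digit0 (S3 x)) eS//; lia.
- by rewrite (@phi0_tail3 (S3 x))// tS; lia.
- by rewrite (@phi0_digit0 (S3 x)) eS//; lia.
Qed.

(** * Measurability of the level sets *)

Lemma measurable_digit n i : measurable [set y : Z3 | y n = i].
Proof. by apply: sub_sigma_algebra; exists n, i. Qed.

Lemma measurable_tail3 : measurable_fun setT tail3.
Proof.
apply: (@measurability _ _ _ _ setT tail3 coordinate_cylinders) => //.
by move=> _ [_ [k [i ->] <-]]; rewrite setTI; exact: measurable_digit.
Qed.

Lemma S3E y : S3 y = add3 one3 y.
Proof.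
apply/funext => k; congr (inord (_ %/ _ %% _)).
by apply: eq_bigr => i _; rewrite addnC.
Qed.

Lemma measurable_S3 : measurable_fun setT S3.
Proof. by rewrite (funext S3E); exact: measurable_add3. Qed.

Lemma phi0_le1 y : (phi0 y <= 1)%N.
Proof.
rewrite /phi0; case: pselect => // nz; case: ex_minnP => k yk _.
by have := ltn_ord (y k); rewrite ltnS leq_eqVlt (negPf yk).
Qed.

(** This form exhibits the level set of 1 as a countable union of finite intersections of digit
    conditions. *)
Lemma phi0_eq1 y : phi0 y = 1%N <->
  exists k, y k = 1%N :> nat /\ forall i, (i < k)%N -> y i = 2%N :> nat.
Proof.
split.
  rewrite /phi0; case: pselect => // nz; case: ex_minnP => k yk kmin y1.
  exists k; split => // i ik; apply/eqP; apply: contraLR ik => yi.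
  by rewrite -leqNgt kmin.
move=> [k [yk y2]]; rewrite /phi0; case: pselect => [nz|[]]; last first.
  by exists k; rewrite yk.
case: ex_minnP => j yj /(_ k); rewrite yk => /(_ isT); rewrite leq_eqVlt.
by case/predU1P => [->//|/y2 e]; rewrite e in yj.
Qed.

Lemma measurable_phi0_eq k : measurable [set y | phi0 y = k].
Proof.
have m1 : measurable [set y | phi0 y = 1%N].
  rewrite (_ : [set y | _] = \bigcup_k ([set y : Z3 | y k = inord 1] `&`
      \bigcap_(i in [set i | (i < k)%N]) [set y : Z3 | y i = inord 2])).
    apply: bigcup_measurable => j _; apply: measurableI.
      exact: measurable_digit.
    by apply: bigcap_measurableType => i _; exact: measurable_digit.
  apply/seteqP; split => y /=; rewrite phi0_eq1.
    move=> [j [yj yi]]; exists j => //; split => [|i ij]; apply/val_inj.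
      by rewrite /= yj inordK.
    by rewrite /= yi// inordK.
  move=> [j _ [/= yj yi]]; exists j; rewrite yj inordK//; split => // i ij.
  by rewrite yi// inordK.
case: k => [|[|k]] //; last first.
  rewrite (_ : mkset _ = set0)//; apply/seteqP; split => // y /= e.
  by have := phi0_le1 y; rewrite e.
(* The complement also accounts for the point with all digits 2, where [phi0] is 0 by convention. *)
rewrite (_ : mkset _ = ~` [set y | phi0 y = 1%N]); first exact: measurableC.
apply/seteqP; split => y /=; first by move=> ->.
by have := phi0_le1 y; case: (phi0 y) => [|[]].
Qed.

Lemma measurable_phi0_sum_eq m k : measurable [set y | phi0_sum m y = k].
Proof.
elim: m k => [|m ih] k.
  have [->|k0] := eqVneq k 0%N.
    rewrite (_ : mkset _ = setT)//; apply/seteqP; split => // y _.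
    by rewrite /= /phi0_sum big_ord0.
  rewrite (_ : mkset _ = set0)//; apply/seteqP; split => // y /=.
  by rewrite /phi0_sum big_ord0 => e; rewrite -e in k0.
rewrite (_ : mkset _ = \bigcup_(j in [set j | (j <= k)%N])
    ([set y | phi0 y = j] `&` S3 @^-1` [set y | phi0_sum m y = (k - j)%N])).
  apply: bigcup_measurable => j _; apply: measurableI.
    exact: measurable_phi0_eq.
  by rewrite -[X in measurable X]setTI; exact: measurable_S3.
apply/seteqP; split => y /=; rewrite -add1n phi0_sumD phi0_sum1 /=.
  by move=> <-; exists (phi0 y); [exact: leq_addr|split => //=; rewrite addKn].
by move=> [j /= jk [-> ->]]; rewrite subnKC.
Qed.

Lemma phi0_sum_le m y : (phi0_sum m y <= m)%N.
Proof.
rewrite -[leqRHS]muln1 -[m in leqRHS]card_ord -sum_nat_const.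
by apply: leq_sum => i _; exact: phi0_le1.
Qed.

Lemma coef_1DXM (R : nzRingType) (p : {poly R}) i :
  ((1 + 'X) * p)`_i = p`_i + (if i == 0%N then 0 else p`_i.-1).
Proof. by rewrite mulrDl mul1r coefD coefXM. Qed.

(** * Self-similarity of Haar measure *)

Section Haar.
Context {R : realType} {mu : probability Z3 R}.
Local Notation P := (limit_poly mu).

Lemma measure_digit_split n (E : set Z3) : measurable E ->
  mu E = (\sum_(i < 3) mu (E `&` [set y | y n = i]))%E.
Proof.
move=> mE; rewrite -measure_bigsetU_ord.
- congr (mu _); apply/seteqP; split => [y Ey|y].
    by rewrite (bigD1 (y n))//=; left.
  by rewrite !big_ord_recl big_ord0 => -[[]|[[]|[[]|[]]]].
- by move=> i; apply: measurableI => //; exact: measurable_digit.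
- by move=> i j _ _ [y [[_ /= <-] [_ /= <-]]].
Qed.

Lemma coef_limit_poly m k :
  (P m)`_k = fine (mu [set y | phi0_sum m y = k]).
Proof.
rewrite coef_poly; case: ltnP => // mk.
rewrite (_ : mkset _ = set0) ?measure0//; apply/seteqP; split => // y /= e.
by have := phi0_sum_le m y; rewrite e leqNgt mk.
Qed.

Hypothesis haar : is_haar mu.

Lemma haar_S3 A : measurable A -> mu (S3 @^-1` A) = mu A.
Proof. by move=> mA; rewrite (funext S3E) haar. Qed.

(** For [j.+1 < 3 ^ n], the preimage of [cylinder n j.+1] under the measure-preserving [S3] is
    [cylinder n j]. *)
Lemma haar_cylinder0 n j : (j < 3 ^ n)%N ->
  mu (cylinder n j) = mu (cylinder n 0).
Proof.
elim: j => // j ih jn; rewrite -ih ?(ltnW jn)// -haar_S3.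
  congr (mu _); apply/seteqP; split => y; rewrite /cylinder/= residue_S3.
    have := residue_lt n y; rewrite leq_eqVlt => /predU1P[->|rn].
      by rewrite modnn.
    by rewrite modn_small// => -[].
  by move=> ->; rewrite modn_small.
exact: measurable_cylinder.
Qed.

Lemma haar_cylinderS n i j : (i < 3 ^ n.+1)%N -> (j < 3 ^ n)%N ->
  mu (cylinder n.+1 i) = ((3^-1)%:E * mu (cylinder n j))%E.
Proof.
move=> iltn jltn.
rewrite (measure_digit_split n _ (measurable_cylinder n j)).
rewrite (eq_bigr (fun=> mu (cylinder n.+1 i))) => [|k _].
  rewrite !big_ord_recl big_ord0 adde0.
  have /fineK <- : mu (cylinder n.+1 i) \is a fin_num.
    by apply: fin_num_measure; exact: measurable_cylinder.
  by rewrite -!EFinD -EFinM; congr EFin; lra.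
rewrite (haar_cylinder0 _ _ iltn).
(* Residue [j + k * 3 ^ n] describes the part of [cylinder n j] whose digit at index [n] is [k]. *)
rewrite -(haar_cylinder0 n.+1 (j + k * 3 ^ n)); last first.
  by rewrite expnS; have := ltn_ord k; nia.
congr (mu _); apply/seteqP; split => y; rewrite /cylinder/= residueS.
  by move=> [-> ->].
move=> e; have e1 : residue n y = j.
  by rewrite -residueS_mod residueS e addnC modnMDl modn_small.
split => //; apply/val_inj/eqP.
rewrite -(eqn_pmul2r (_ : 0 < 3 ^ n)%N) ?expn_gt0//.
by move: e; rewrite e1 => /addnI ->.
Qed.

(** The lowest digit is uniform and independent of the tail, which is again Haar distributed. Both
    sides are finite measures in [A] that agree on the intersection-stable family of cylinders. *)
Lemma haar_digit0_tail3 (i : 'I_3) (A : set Z3) : measurable A ->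
  mu ([set y | y 0%N = i] `&` tail3 @^-1` A) = ((3^-1)%:E * mu A)%E.
Proof.
move=> mA.
pose m1 : {measure set Z3 -> \bar R} :=
  @measure_function_pushforward__canonical__measure_function_Measure
    _ _ _ _ _ (mrestr mu (measurable_digit 0 i)) _ measurable_tail3.
have i3 : 0 <= 3^-1 :> R by rewrite invr_ge0.
pose m2 : {measure set Z3 -> \bar R} := mscale (NngNum i3) mu.
suff : m1 A = m2 A by rewrite setIC.
have sA : <<s cylinders >> A by rewrite -measurable_cylindersE.
have c0 : cylinder 0 0 = setT.
  by apply/seteqP; split => // y _; rewrite /cylinder/= /residue big_ord0.
have cylinders_measurable : cylinders `<=` measurable.
  by move=> B [->//|[n [j ->]]]; exact: measurable_cylinder.
apply: (@g_sigma_algebra_measure_unique _ _ _ _ cylinders_measurable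
    (fun=> cylinder 0 0) _ _ m1 m2) sA => //.
- by move=> _; right; exists 0%N, 0%N.
- by rewrite bigcup_const// c0.
- exact: setI_closed_cylinders.
- move=> _ [->|[n [j ->]]]; first by rewrite !measure0.
  have [jn|jn] := ltnP j (3 ^ n)%N; last first.
    rewrite (_ : cylinder n j = set0) ?measure0//; apply/seteqP; split => // y.
    by rewrite /cylinder/= => e; have := residue_lt n y; rewrite e ltnNge jn.
  have ilt : (i + j * 3 < 3 ^ n.+1)%N.
    by rewrite expnS; have := ltn_ord i; lia.
  rewrite -[RHS](haar_cylinderS _ _ _ ilt jn); congr (mu _).
  apply/seteqP; split => y; rewrite /cylinder/= residue_tail3.
    by move=> [-> ->].
  have := ltn_ord (y 0%N); have := ltn_ord i => lti ltyi e.
  by split; [|apply/val_inj => /=]; lia.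
- move=> _; apply: (@le_lt_trans _ _ (mu setT)).
    apply: le_measure; rewrite ?inE//.
    apply: measurableI; last exact: measurable_digit.
    rewrite -[X in measurable X]setTI.
    by apply: measurable_tail3 => //; exact: measurable_cylinder.
  by rewrite probability_setT ltry.
Qed.

(** * Recursions and first values of the limit polynomials *)

(** Conditioning on the lowest digit [i], of probability 1/3, leaves a constant plus a sum along a
    Haar-distributed tail; in generating functions the constant becomes the factor ['X^(c i)]. *)
Lemma limit_poly_split m (c l : 'I_3 -> nat) :
  (forall y, phi0_sum m y = (c (y 0%N) + phi0_sum (l (y 0%N)) (tail3 y))%N) ->
  P m = 3^-1 *: \sum_(i < 3) 'X^(c i) * P (l i).
Proof.
move=> mE; apply/polyP => n; rewrite coef_limit_poly coefZ coef_sum.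
rewrite (measure_digit_split 0); last exact: measurable_phi0_sum_eq.
rewrite big_distrr/= -sum_fine => [|i _]; last first.
  apply: fin_num_measure; apply: measurableI; last exact: measurable_digit.
  exact: measurable_phi0_sum_eq.
apply: eq_bigr => i _; rewrite coefXnM; case: ltnP => cn.
  rewrite mulr0 (_ : _ `&` _ = set0) ?measure0//.
  by apply/seteqP; split => // y [/= + yi]; rewrite mE yi; lia.
rewrite coef_limit_poly; set A := [set y | _ = (n - _)%N].
have mA : measurable A by exact: measurable_phi0_sum_eq.
rewrite (_ : _ `&` _ = [set y | y 0%N = i] `&` tail3 @^-1` A).
  rewrite haar_digit0_tail3// fineM//; exact: fin_num_measure.
by rewrite setIC; apply/seteqP; split => y [/= yi]; rewrite mE yi /A/= => e;
  split => //; lia.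
Qed.

Lemma limit_poly0 : P 0 = 1.
Proof.
apply/polyP => k; rewrite coef_limit_poly coef1.
rewrite (_ : mkset _ = [set _ | 0%N = k]); last first.
  by apply/seteqP; split => y; rewrite /= /phi0_sum big_ord0.
case: k => [|k] /=.
  by rewrite (_ : mkset _ = setT) ?probability_setT//; apply/seteqP; split.
by rewrite (_ : mkset _ = set0) ?measure0//; apply/seteqP; split.
Qed.

Lemma limit_poly_mul3 k : P (k * 3) = 'X^k * P k.
Proof.
rewrite (@limit_poly_split _ (fun=> k) (fun=> k)) ?big_const_ord; last first.
  exact: phi0_sum_mul3.
rewrite /= addr0 -!mulr2n -mulrS.
by rewrite -scalerMnr scalerMnl -mulr_natr mulVf ?scale1r// pnatr_eq0.
Qed.

Lemma limit_poly_mul3D1 k :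
  P (k * 3 + 1) = 'X^k * (3^-1 *: ((1 + 'X) * P k + P k.+1)).
Proof.
rewrite (@limit_poly_split _ (fun i => if i == 2%N :> nat then k else k + i)%N
  (fun i => if i == 2%N :> nat then k.+1 else k)) => [|y]; last first.
  by rewrite phi0_sum_mul3D1; case: ifP.
rewrite !big_ord_recl big_ord0/= addn0 addr0 exprD -scalerAr; congr (_ *: _).
by rewrite expr1; ring.
Qed.

Lemma limit_poly_mul3D2 k :
  P (k * 3 + 2) = 'X^k * (3^-1 *: ('X * P k + (1 + 'X) * P k.+1)).
Proof.
rewrite (@limit_poly_split _
  (fun i => if i == 0%N :> nat then k.+1 else k + (i == 1%N :> nat))%N
  (fun i => if i == 0%N :> nat then k else k.+1)) => [|y]; last first.
  by rewrite phi0_sum_mul3D2; case: ifP.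
rewrite !big_ord_recl big_ord0/= addn0 addr0 exprD exprSr -scalerAr.
by congr (_ *: _); rewrite expr1; ring.
Qed.

(** At [k = 0] the recursion expresses [P 1] through itself, and this linear equation is solved
    coefficientwise. *)
Lemma limit_poly1 : P 1 = 2^-1 *: (1 + 'X).
Proof.
apply/polyP => i.
have := congr1 (fun p : {poly R} => p`_i) (limit_poly_mul3D1 0).
rewrite add0n limit_poly0 expr0 mul1r mulr1 !coefZ !coefD; lra.
Qed.

Lemma limit_poly2 : P 2 = 6^-1 *: (1 + 4 *: 'X + 'X^2).
Proof.
have := limit_poly_mul3D2 0; rewrite add0n => ->.
rewrite limit_poly0 limit_poly1 expr0 mul1r mulr1.
apply/polyP => i.
rewrite -scalerAr !(coefZ, coefD, mulrDl, mulrDr, mul1r, mulr1) -expr2.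
by rewrite coef1 coefX coefXn; field.
Qed.

(* [P m] is computed from [P k] and [P k.+1] with [k := m %/ 3], so the invariant
   has to be about pairs. *)
Definition consecutive n k (a b : R) :=
  exists l A B, [/\ P k = 'X^l * A, P k.+1 = 'X^l * B,
    [/\ (size A <= n.+1)%N, (size B <= n.+2)%N, 0 < A`_n & 0 < B`_n.+1] &
    [/\ A`_0 = a, B`_0 = b, 0 < b & b < a / 2]].

(** * Behaviour of the pair invariant under appending a ternary digit *)

Lemma consecutive1 : consecutive 1 1 2^-1 6^-1.
Proof.
exists 0%N, (P 1), (P 2); rewrite !expr0 !mul1r limit_poly1 limit_poly2.
split => //; split.
- apply/leq_sizeP => -[|[|j]]// _.
  by rewrite coefZ coefD coef1 coefX addr0 mulr0.
- apply/leq_sizeP => -[|[|[|j]]]// _.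
  by rewrite !(coefZ, coefD) coef1 coefX coefXn !(addr0, mulr0).
- rewrite coefZ coefD coef1 coefX/=; lra.
- rewrite !(coefZ, coefD) coef1 coefX coefXn/=; lra.
- rewrite coefZ coefD coef1 coefX/=; lra.
- rewrite !(coefZ, coefD) coef1 coefX coefXn/=; lra.
- lra.
- lra.
Qed.

(** Appending the digit 1 raises both degrees, the new top coefficients being positive combinations
    of old ones. The inequality [b / 3 < (a + b) / 6] amounts to [b < a]. *)
Lemma consecutive_mul3D1 n k a b : consecutive n k a b ->
  consecutive n.+1 (k * 3 + 1) ((a + b) / 3) (b / 3).
Proof.
move=> [l [A [B [PA PB [sA sB An Bn] [A0 B0 b0 ba]]]]].
have z (p : {poly R}) i : (size p <= i)%N -> p`_i = 0 by exact: nth_default.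
exists (k + l)%N, (3^-1 *: ((1 + 'X) * A + B)),
  (3^-1 *: ('X * A + (1 + 'X) * B)); split.
- rewrite limit_poly_mul3D1 PA PB exprD -!mulrA; congr (_ * _).
  by rewrite -scalerAr mulrDr; congr (_ *: (_ + _)); ring.
- rewrite -addn1 -addnA limit_poly_mul3D2 PA PB exprD -!mulrA; congr (_ * _).
  by rewrite -scalerAr mulrDr; congr (_ *: (_ + _)); ring.
- split.
  + apply/leq_sizeP => i ni; rewrite coefZ coefD coef_1DXM.
    by rewrite !z ?if_same ?addr0 ?mulr0//; lia.
  + apply/leq_sizeP => i ni; rewrite coefZ coefD coef_1DXM coefXM.
    by rewrite !z ?if_same ?addr0 ?mulr0//; lia.
  + rewrite coefZ coefD coef_1DXM/= (z A n.+1)//; lra.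
  + rewrite coefZ coefD coef_1DXM coefXM/= (z A n.+1)// (z B n.+2)//; lra.
- rewrite !coefZ !coefD !coef_1DXM coefXM/= A0 B0.
  by split; lra.
Qed.

(** Appending the digit 0 keeps [A] and both degrees; [(a + b) / 3 < a / 2] is equivalent to
    [b < a / 2]. *)
Lemma consecutive_mul3 n k a b : consecutive n k a b ->
  consecutive n (k * 3) a ((a + b) / 3).
Proof.
move=> [l [A [B [PA PB [sA sB An Bn] [A0 B0 b0 ba]]]]].
have z (p : {poly R}) i : (size p <= i)%N -> p`_i = 0 by exact: nth_default.
exists (k + l)%N, A, (3^-1 *: ((1 + 'X) * A + B)); split.
- by rewrite limit_poly_mul3 PA exprD mulrA.
- rewrite -addn1 limit_poly_mul3D1 PA PB exprD -!mulrA; congr (_ * _).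
  by rewrite -scalerAr mulrDr; congr (_ *: (_ + _)); ring.
- split => //.
  + apply/leq_sizeP => i ni; rewrite coefZ coefD coef_1DXM.
    by rewrite !z ?if_same ?addr0 ?mulr0//; lia.
  + rewrite coefZ coefD coef_1DXM/= (z A n.+1)//; lra.
- rewrite !coefZ !coefD !coef_1DXM/= A0 B0.
  by split; lra.
Qed.

(** * Reduced polynomials and the infinite family *)

Lemma reduced_limit_polyE m l (Q : {poly R}) :
  P m = 'X^l * Q -> Q`_0 != 0 -> reduced_limit_poly mu m = Q.
Proof.
move=> PQ Q0; rewrite /reduced_limit_poly.
suff -> : low_exp (P m) = l.
  apply/polyP => i; rewrite coef_drop_poly PQ coefXnM ltnNge leq_addl/=.
  by rewrite addnK.
have Pl : (P m)`_l = Q`_0 by rewrite PQ coefXnM ltnn subnn.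
have lP : (l < size (P m))%N.
  by rewrite ltnNge; apply: contra Q0 => sP; rewrite -Pl nth_default.
have hP : has (fun c => c != 0) (P m).
  by apply/(has_nthP 0); exists l => //; rewrite Pl.
apply/eqP; rewrite eqn_leq; apply/andP; split.
  rewrite leqNgt; apply/negP => /(before_find 0).
  by rewrite Pl (negPf Q0).
rewrite leqNgt; apply/negP => fl.
by have := nth_find 0 hP; rewrite -/(low_exp _) {1}PQ coefXnM fl eqxx.
Qed.

Lemma consecutive_reduced n k a b : consecutive n k a b ->
  size (reduced_limit_poly mu k.+1) = n.+2 /\
  (reduced_limit_poly mu k.+1)`_0 = b.
Proof.
move=> [l [A [B [PA PB [sA sB An Bn] [A0 B0 b0 ba]]]]].
rewrite (reduced_limit_polyE _ _ _ PB) ?B0 ?gt_eqF//; split => //.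
apply/eqP; rewrite eqn_leq sB/= ltnNge; apply/negP => /leq_sizeP/(_ _ (leqnn _)).
by move=> e; rewrite e ltxx in Bn.
Qed.

Lemma exists_consecutive n : exists k a b, consecutive n.+1 k a b.
Proof.
elim: n => [|n [k [a [b /consecutive_mul3D1]]]].
  by exists 1%N, 2^-1, 6^-1; exact: consecutive1.
by exists (k * 3 + 1)%N, ((a + b) / 3), (b / 3).
Qed.

(** The fixed point of [b] mapped to [(a + b) / 3] is [a / 2], and each step divides the distance to
    it by 3. *)
Lemma consecutive_iter n k a b i : consecutive n k a b ->
  consecutive n (k * 3 ^ i) a (a / 2 - (a / 2 - b) / 3 ^+ i).
Proof.
move=> c; elim: i => [|i /consecutive_mul3].
  by rewrite expn0 muln1 expr0 divr1 opprB addrCA subrr addr0.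
rewrite expnSr mulnA exprSr; congr (consecutive _ _ _ _).
by field; rewrite expf_neq0// pnatr_eq0.
Qed.

End Haar.

(* A polynomial has degree d >= 0 exactly when its size is d.+1. *)
Theorem theorem12 (R : realType) (mu : probability Z3 R) (haar : is_haar mu)
    (d : nat) (hd : (2 <= d)%N) :
  infinite_set [set p : {poly R} |
    (exists2 m : nat, (1 <= m)%N & p = reduced_limit_poly mu m) /\
    size p = d.+1].
Proof.
case: d hd => [|[|d]]// _.
(* Here [d] stands for the degree minus 2: the invariant at [d.+1] gives reduced polynomials of size
   [d.+3]. *)
have [k [a [b c]]] := exists_consecutive haar d.
have ba : a / 2 - b != 0.
  by case: c => [l [A [B [_ _ _ [_ _ _ ba]]]]]; lra.
pose f i := reduced_limit_poly mu (k * 3 ^ i).+1.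
have fc i := consecutive_reduced _ _ _ _ (consecutive_iter haar _ _ _ _ i c).
(* A finite set would have a finite preimage under the injective [f], yet that preimage is all of
   [nat]. *)
move=> /(@finite_preimage _ _ _ f) fin; apply: infinite_nat.
apply: sub_finite_set (fin _) => [i _|i j _ _ fij].
  by split; [exists (k * 3 ^ i).+1|have [] := fc i].
(* Equal polynomials have equal constant terms; since the gap [a / 2 - b] is nonzero, these
   determine [3 ^+ i] and hence [i]. *)
have [_] := fc i; have [_] := fc j; rewrite -/(f i) -/(f j) fij => -> /addrI.
move=> /oppr_inj/(mulfI ba)/invr_inj/esym; apply: ieexprIn => //.
by rewrite gt_eqF// ltr1n.
Qed.
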